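(* Let $(x_k)_{k\ge 0}$, $(d_k)_{k\ge 0}$ be generated by Algorithm RDRSOM (defined in the context) with subspaces $\mathcal V_k\subset \mathrm T_{x_k}\mathcal M$ and regularization parameters $\gamma_k>0$. Suppose there is a constant $M>0$ such that for every $k$ the following three conditions hold: $$\Big|f(\mathrm{Retr}_{x_k}(d_k))-\Big(f(x_k)+\langle d_k,\mathrm{grad} f(x_k)\rangle+\tfrac12\langle d_k,\mathrm{Hess} f(x_k)[d_k]\rangle\Big)\Big|\le \tfrac{M}{6}\|d_k\|^3,$$ $$\big\|\mathrm{grad} f(\mathrm{Retr}_{x_k}(d_k))-\mathrm{grad} f(x_k)-\mathrm{Hess} f(x_k)[d_k]\big\|\le \tfrac M2\|d_k\|^2,$$ $$\big\|\mathrm{Proj}_{\mathcal V_k}(\mathrm{Hess} f(x_k)[d_k])-\mathrm{Hess} f(x_k)[d_k]\big\|\le \tfrac M2\|d_k\|^2.$$ Suppose moreover that for every $k$, $\mathrm{grad} f(x_k)\in\mathcal V_k$ and $C>\gamma_k\ge M$ for a constant $C$ independent of $k$, and that $f^*:=\inf_{x\in\mathcal M}f(x)>-\infty$ is the optimal value. Then for every integer $N\ge1$ (such that $x_0,\dots,x_{N+1}$ are generated), $$\min_{0\le k\le N+1}\|\mathrm{grad} f(x_k)\|\le \frac{12^{2/3}(2M+C)}{2M^{2/3}}\left(\frac{f(x_0)-f^*}{N}\right)^{2/3}.$$ Consequently, the algorithm with tolerance $\epsilon>0$ terminates within $O(1/\epsilon^{3/2})$ iterations, i.e. within $K\epsilon^{-3/2}$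 iterations for some constant $K$ independent of $\epsilon$.
   Context: Setting: $\mathcal M$ is a Riemannian manifold embedded in a finite-dimensional Euclidean space $\mathcal E$ (with inner product $\langle\cdot,\cdot\rangle$ and norm $\|\cdot\|$, tangent spaces $\mathrm T_x\mathcal M\subset\mathcal E$ carrying the induced inner product), and $f:\mathcal M\to\mathbb R$ is sufficiently smooth. The problem is $\min\{f(x):x\in\mathcal M\}$. $\mathrm{Proj}_x:\mathcal E\to \mathrm T_x\mathcal M$ is the orthogonal projection. The Riemannian gradient is $\mathrm{grad} f(x)=\mathrm{Proj}_x\nabla f(x)\in \mathrm T_x\mathcal M$, and the Riemannian Hessian is the linear map $\mathrm{Hess} f(x):\mathrm T_x\mathcal M\to \mathrm T_x\mathcal M$, $\mathrm{Hess} f(x)[h]=\mathrm{Proj}_x(\mathrm D\,\mathrm{grad} f(x)[h])$. Gradients at different points are subtracted as vectors of $\mathcal E$. For each $x\in\mathcal M$, $\mathrm{Retr}_x:\mathrm T_x\mathcal M\to\mathcal M$ is a retraction: $\mathrm{Retr}_x(0)=x$ and $\mathrm D\mathrm{Retr}_x(0)$ is the identity. For a linear subspace $\mathcal V_k$, $\mathrm{Proj}_{\mathcal V_k}$ is the orthogonal projection onto $\mathcal V_k$. Algorithm RDRSOM: input $x_0\in\mathcal M$ and $\epsilon>0$; set $k=0$. While $\|\mathrm{grad} f(x_k)\|\ge\epsilon$: choose a linear subspace $\mathcal V_k\subset \mathrm T_{x_k}\mathcal M$ and $\gamma_k>0$; let $d_k$ be a global minimizer over $d\in\mathcal V_k$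 of $$f(x_k)+\langle \mathrm{grad} f(x_k),d\rangle+\tfrac12\langle \mathrm{Hess} f(x_k)[d],d\rangle+\tfrac{\gamma_k}{6}\|d\|^3;$$ set $x_{k+1}=\mathrm{Retr}_{x_k}(d_k)$ and $k\leftarrow k+1$. *)

(* Defs.v *)
From HB Require Import structures.
From mathcomp Require Import all_boot all_order all_algebra.
From mathcomp Require Import boolp classical_sets functions reals.
From mathcomp Require Import topology normedtype derive exp.

Set Implicit Arguments.
Unset Strict Implicit.
Unset Printing Implicit Defensive.

Import Order.TTheory GRing.Theory Num.Theory.
Import numFieldNormedType.Exports.

Local Open Scope classical_set_scope.
Local Open Scope ring_scope.

(* A Euclidean space: a finite-dimensional normed space (vectType gives the
   finite dimension and the type {vspace E} of linear subspaces) whose norm,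
   and hence whose topology, comes from an inner product. *)
HB.mixin Record NormedModule_isEuclidean (R : realType) E
    of NormedModule R E & Vector R E := {
  inner : E -> E -> R ;
  innerC : forall u v, inner u v = inner v u ;
  innerDl : forall u v w, inner (u + v) w = inner u w + inner v w ;
  innerZl : forall (a : R) u v, inner (a *: u) v = a * inner u v ;
  inner_norm : forall u : E, inner u u = `|u| ^+ 2
}.

#[short(type="euclideanType")]
HB.structure Definition Euclidean (R : realType) :=
  { E of NormedModule R E & Vector R E & NormedModule_isEuclidean R E }.

(* f is of class C^n on the open set U.  On a finite-dimensional V the last
   clause says that the derivative of f is of class C^(n-1). *)
Fixpoint class_C (R : realType) (V W : normedModType R) (n : nat)
    (U : set V) (f : V -> W) : Prop :=
  match n with
  | 0%N => forall x, U x -> {for x, continuous f}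
  | m.+1 => (forall x, U x -> differentiable f x) /\
            (forall v : V, class_C m U ('D_v f))
  end.

Section Euclidean.
Variables (R : realType) (E : euclideanType R).

(* The orthogonal projection onto S, meant for S a linear subspace (0 when no
   orthogonal projection exists, which cannot happen for a subspace). *)
Definition oproj (S : set E) (v : E) : E :=
  xget 0 [set p | S p /\ forall w, S w -> inner (v - p) w = 0].

Definition egrad (f : E -> R) (x : E) : E :=
  xget 0 [set g | forall v, inner g v = 'd f x v].

(* M is locally the zero set of a C^oo submersion into R^k, where k is the
   codimension (k = 0 gives the open subsets of E). *)
Definition embedded_submanifold (M : set E) : Prop :=
  exists k : nat, forall x, M x ->
  exists (U : set E) (h : E -> 'rV[R]_k),
    [/\ open U /\ U x,
        forall n, class_C n U h,
        forall y, U y -> (M y <-> h y = 0)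
      & forall w, exists v, 'd h x v = w].

Definition curve_through (M : set E) (x v : E) (c : R -> E) : Prop :=
  [/\ c 0 = x, \forall t \near (0 : R), M (c t) & is_derive (0 : R) 1 c v].

(* The tangent space T_x M, as the set of velocities at x of curves in M. *)
Definition tangent (M : set E) (x : E) : set E :=
  [set v | exists c, curve_through M x v c].

(* The derivative D F(x)[v] of a map F defined on M, for v in T_x M: the common
   value of (F o c)'(0) over the curves c in M with c(0) = x and c'(0) = v. *)
Definition mderive (M : set E) (F : E -> E) (x v : E) : E :=
  xget 0 [set w | forall c, curve_through M x v c ->
                    is_derive (0 : R) 1 (F \o c) w].

Definition rgrad (M : set E) (f : E -> R) (x : E) : E :=
  oproj (tangent M x) (egrad f x).

Definition rhess (M : set E) (f : E -> R) (x v : E) : E :=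
  oproj (tangent M x) (mderive M (rgrad M f) x v).

(* Only the values Retr x v with x in M and v in T_x M are meaningful; the last
   clause says that the differential at 0 of Retr x : T_x M -> M is the
   identity of T_x M. *)
Definition retraction (M : set E) (Retr : E -> E -> E) : Prop :=
  forall x, M x ->
    [/\ forall v, tangent M x v -> M (Retr x v),
        Retr x 0 = x
      & forall e : R, 0 < e ->
          \forall v \near (0 : E), tangent M x v ->
            `|Retr x v - (x + v)| <= e * `|v| ].

Definition cubic_model (M : set E) (f : E -> R) (gamma : R) (x d : E) : R :=
  f x + inner (rgrad M f x) d + 2^-1 * inner (rhess M f x d) d
  + gamma / 6 * `|d| ^+ 3.

(* Iteration k is carried out, so that x_0, ..., x_(k+1) are generated: the
   loop test succeeds at x_0, ..., x_k. *)
Definition performed (M : set E) (f : E -> R) (eps : R) (x : nat -> E)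
    (k : nat) : Prop :=
  forall j, (j <= k)%N -> eps <= `|rgrad M f (x j)|.

(* The sequences are total functions of k, but they are constrained only on the
   iterations that are carried out. *)
Definition rdrsom (M : set E) (f : E -> R) (Retr : E -> E -> E) (eps : R)
    (x0 : E) (x d : nat -> E) (V : nat -> {vspace E}) (gamma : nat -> R)
    : Prop :=
  x 0%N = x0 /\
  forall k, performed M f eps x k ->
    [/\ [set` V k] `<=` tangent M (x k),
        0 < gamma k,
        d k \in V k,
        forall u, u \in V k ->
          cubic_model M f (gamma k) (x k) (d k)
            <= cubic_model M f (gamma k) (x k) u
      & x k.+1 = Retr (x k) (d k)].

Definition value_accuracy (M : set E) (f : E -> R) (Retr : E -> E -> E)
    (Mc : R) (x d : E) : Prop :=
  `|f (Retr x d) - (f x + inner d (rgrad M f x)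
                    + 2^-1 * inner d (rhess M f x d))|
    <= Mc / 6 * `|d| ^+ 3.

Definition grad_accuracy (M : set E) (f : E -> R) (Retr : E -> E -> E)
    (Mc : R) (x d : E) : Prop :=
  `|rgrad M f (Retr x d) - rgrad M f x - rhess M f x d| <= Mc / 2 * `|d| ^+ 2.

Definition hess_accuracy (M : set E) (f : E -> R) (Mc : R) (V : {vspace E})
    (x d : E) : Prop :=
  `|oproj [set` V] (rhess M f x d) - rhess M f x d| <= Mc / 2 * `|d| ^+ 2.

Definition rdrsom_assumptions (M : set E) (f : E -> R) (Retr : E -> E -> E)
    (Mc C eps : R) (x d : nat -> E) (V : nat -> {vspace E}) (gamma : nat -> R)
    : Prop :=
  forall k, performed M f eps x k ->
    [/\ value_accuracy M f Retr Mc (x k) (d k),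
        grad_accuracy M f Retr Mc (x k) (d k),
        hess_accuracy M f Mc (V k) (x k) (d k),
        rgrad M f (x k) \in V k
      & Mc <= gamma k < C].

(* The algorithm stops at x_n, after exactly n iterations. *)
Definition terminates_after (M : set E) (f : E -> R) (eps : R) (x : nat -> E)
    (n : nat) : Prop :=
  (forall j, (j < n)%N -> eps <= `|rgrad M f (x j)|) /\
  `|rgrad M f (x n)| < eps.

End Euclidean.

(* Main.v *)
Require Import Defs.
From HB Require Import structures.
From mathcomp Require Import all_boot all_order all_algebra.
From mathcomp Require Import boolp classical_sets functions reals.
From mathcomp Require Import topology normedtype derive exp.
From mathcomp Require Import ring lra landau sequences interval_inference.

Import Order.TTheory GRing.Theory Num.Theory.
Import numFieldNormedType.Exports.

Local Open Scope classical_set_scope.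
Local Open Scope ring_scope.

Set Implicit Arguments.
Unset Strict Implicit.
Unset Printing Implicit Defensive.

(** The rate comes from one iteration. Write g and H for the gradient and the
    Hessian at x, and d for the minimizer of the cubic model over V. If H is
    linear and symmetric on V, then stationarity reads
    <g, w> + <H d, w> + (gamma/2) |d| <d, w> = 0 for all w in V
    ([cubic_stationary]).
    - Taking w = d, and comparing d with - d (which gives <g, d> <= 0), the
      quadratic part of the model at d is at most - (gamma/4) |d|^3. With
      gamma >= Mc and the cubic error bound on the values, an iteration decreases
      f by at least (Mc/12) |d|^3 ([iteration_decrease]).
    - As g is in V, stationarity says that g + Proj_V (H d) = - (gamma/2) |d| d.
      The two quadratic error bounds then bound the next gradient by
      ((2 Mc + C)/2) |d|^2 ([iteration_gradient]).
    The decreases over n iterations add up to at most f x0 - inf f, so one of the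
    steps satisfies |d|^3 <= 12 (f x0 - inf f) / (Mc n), and the gradient after
    that step has the announced size. The complexity bound solves this for n.

    The linearity and the symmetry of the Riemannian Hessian, as defined through
    derivatives along curves, have to be proved ([rhess_symmetric]). Near x the
    manifold is the zero set of h = (h_1, ..., h_k), and the normal space at y is
    spanned by the gradients n_i(y) of the h_i. At the points y of M near x,
    - the tangent space is the kernel of the differential of h ([tangent_ker]).
      A vector v of this kernel is the velocity of a curve y + t v + A(s(t)),
      where A is a right inverse of the differential and s(t) = o(t), solving
      h = 0, is a fixed point of a contraction ([constraint_curve]);
    - hence grad f(y) = nabla f(y) - sum_i lambda_i(y) n_i(y), where lambda is
      given by the inverse of the Gram matrix of the n_i(y). The right-hand side
      makes sense off M and is differentiable at x, so that the derivative along
      curves is its ordinary differential ([mderive_rgrad]).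
    For v and w tangent at x, n_i(x) is orthogonal to w, so the terms in the
    derivatives of lambda_i disappear from <Hess f(x)[v], w>, which becomes
    D_v D_w f(x) - sum_i lambda_i(x) D_v D_w h_i(x). This is symmetric because
    second derivatives commute ([young]). *)

(** * Inner products, orthogonal projections and gradients *)

Section InnerProduct.
Context {R : realType} {E : euclideanType R}.
Implicit Types (u v w : E) (W : {vspace E}).

Lemma innerDr u v w : inner u (v + w) = inner u v + inner u w.
Proof. by rewrite innerC innerDl !(innerC u). Qed.

Lemma innerZr (a : R) u v : inner u (a *: v) = a * inner u v.
Proof. by rewrite innerC innerZl innerC. Qed.

(** The partial application of the inner product that is linear in its argument,
    so that the linear function and the differential lemmas apply to it. *)
Definition innerr v : E -> R := inner ^~ v.

Lemma innerr_is_linear v : linear (innerr v).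
Proof. by move=> a u w; rewrite /innerr innerDl innerZl. Qed.

HB.instance Definition _ v :=
  GRing.isLinear.Build R E R *:%R (innerr v) (innerr_is_linear v).

Lemma inner0l v : inner 0 v = 0. Proof. exact: (linear0 (innerr v)). Qed.
Lemma innerNl u v : inner (- u) v = - inner u v.
Proof. exact: (linearN (innerr v)). Qed.
Lemma innerBl u w v : inner (u - w) v = inner u v - inner w v.
Proof. exact: (linearB (innerr v)). Qed.
Lemma inner_suml (I : finType) (F : I -> E) v :
  inner (\sum_i F i) v = \sum_i inner (F i) v.
Proof. exact: (linear_sum (innerr v)). Qed.
Lemma inner0r v : inner v 0 = 0. Proof. by rewrite innerC inner0l. Qed.
Lemma innerNr u v : inner u (- v) = - inner u v.
Proof. by rewrite innerC innerNl innerC. Qed.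
Lemma innerBr u w v : inner v (u - w) = inner v u - inner v w.
Proof. by rewrite innerDr innerNr. Qed.

Lemma inner_ge0 u : 0 <= inner u u.
Proof. by rewrite inner_norm exprn_ge0. Qed.

Lemma inner_eq0 u : inner u u = 0 -> u = 0.
Proof. by move/eqP; rewrite inner_norm sqrf_eq0 normr_eq0 => /eqP. Qed.

(** Expand the square of |v|^2 u - <u, v> v, which is nonnegative. *)
Lemma cauchy_schwarz u v : `|inner u v| <= `|u| * `|v|.
Proof.
have [->|v0] := eqVneq v 0; first by rewrite inner0r !normr0 mulr0.
have nv : 0 < `|v| ^+ 2 by rewrite exprn_gt0 // normr_gt0.
rewrite -ler_sqr ?nnegrE ?mulr_ge0 // exprMn real_normK ?num_real //.
have := inner_ge0 (`|v| ^+ 2 *: u - inner u v *: v).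
rewrite innerBl !innerBr !innerZl !innerZr !inner_norm (innerC v u) => H.
rewrite -(ler_pM2l nv); move: H; set a := `|u| ^+ 2; set b := `|v| ^+ 2.
by nra.
Qed.

Lemma innerr_continuous v : continuous (innerr v).
Proof.
apply: bounded_linear_continuous; apply/bounded_funP => r.
exists (r * `|v|) => u ur; rewrite (le_trans (cauchy_schwarz _ _)) //.
exact: ler_wpM2r.
Qed.

Definition orthonormal_family n (e : 'I_n -> E) :=
  forall i j, inner (e i) (e j) = (i == j)%:R.

(** Gram-Schmidt by induction on the dimension: split off a unit vector u of W
    and apply the induction hypothesis to the orthogonal complement of u in W. *)
Lemma orthonormal_basis W : exists n (e : 'I_n -> E),
  [/\ orthonormal_family e, forall i, e i \in W &
      forall v, v \in W -> v = \sum_i inner v (e i) *: e i].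
Proof.
have [m] := ubnP (\dim W); elim: m W => // m IH W; rewrite ltnS => dW.
have [W0|Wn0] := eqVneq W 0%VS.
  exists 0%N, (fun i : 'I_0 => 0); split => [[]//|[]//|v].
  by rewrite W0 memv0 big_ord0 => /eqP.
pose u0 := vpick W; have u0n0 : u0 != 0 by rewrite vpick0.
pose u := `|u0|^-1 *: u0.
have uW : u \in W by rewrite memvZ // memv_pick.
have uu : inner u u = 1.
  by rewrite inner_norm normrZ normfV normr_id mulVf ?normr_eq0 // expr1n.
pose K := lker (linfun (innerr u : E -> R^o)).
have KE v : (v \in K) = (inner v u == 0) by rewrite memv_ker lfunE.
have [|n [e [eo eW eE]]] := IH (W :&: K)%VS.
  apply: leq_trans dW; rewrite (ltn_leqif (dimv_leqif_sup (capvSl W K))).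
  apply/negP => /subvP /(_ _ uW); rewrite memv_cap KE uu oner_eq0 andbF.
  by [].
have eWK i : e i \in W /\ inner (e i) u = 0.
  by have := eW i; rewrite memv_cap KE => /andP[-> /eqP].
exists n.+1, (fun i => oapp e u (unlift ord0 i)); split.
- move=> i j; have [i' ->|->] := unliftP ord0 i; have [j' ->|->] := unliftP ord0 j.
  + by rewrite eo (inj_eq lift_inj).
  + by rewrite (eWK i').2.
  + by rewrite innerC (eWK j').2.
  + by rewrite uu eqxx.
- by move=> i; case: unliftP => [i' _|_] //=; exact: (eWK i').1.
- move=> v vW; rewrite big_ord_recl unlift_none /=.
  have /eE vE : v - inner v u *: u \in (W :&: K)%VS.
    rewrite memv_cap KE innerBl innerZl uu mulr1 subrr eqxx andbT.
    by rewrite memvB // memvZ.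
  rewrite -{1}(subrK (inner v u *: u) v) vE addrC; congr (_ + _).
  apply: eq_bigr => i _.
  by rewrite liftK /= innerBl innerZl (innerC u) (eWK i).2 mulr0 subr0.
Qed.

Lemma oproj_eq W v p : p \in W -> (forall w, w \in W -> inner (v - p) w = 0) ->
  oproj [set` W] v = p.
Proof.
move=> pW orth; apply: xget_unique => [|q [/= qW qorth]]; first by split.
have pqW : q - p \in W by rewrite memvB.
apply/eqP; rewrite -subr_eq0; apply/eqP/inner_eq0.
have {1}-> : q - p = (v - p) - (v - q) by rewrite opprB [RHS]addrC addrA subrK.
by rewrite innerBl (qorth _ pqW) orth // subrr.
Qed.

Lemma oproj_vspaceP W v : oproj [set` W] v \in W /\
  forall w, w \in W -> inner (v - oproj [set` W] v) w = 0.
Proof.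
have [n [e [eo eW eE]]] := orthonormal_basis W.
have pW : \sum_i inner v (e i) *: e i \in W.
  by apply: memv_suml => i _; rewrite memvZ.
have porth w : w \in W -> inner (v - \sum_i inner v (e i) *: e i) w = 0.
  move=> /eE ->; rewrite innerC inner_suml big1 // => i _.
  rewrite innerZl [inner (e i) _]innerC innerBl inner_suml (bigD1 i) //= innerZl eo eqxx mulr1.
  rewrite big1 ?addr0 ?subrr ?mulr0 // => j ji.
  by rewrite innerZl eo (negbTE ji) mulr0.
by rewrite (oproj_eq pW porth).
Qed.

Lemma inner_oproj W v w : w \in W -> inner (oproj [set` W] v) w = inner v w.
Proof.
move=> wW; have [_ /(_ w wW)] := oproj_vspaceP W v.
by rewrite innerBl => /eqP; rewrite subr_eq0 => /eqP.
Qed.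

(** The Riesz representation of the linear form ['d f x], by its coordinates in
    an orthonormal basis. *)
Lemma egradP (f : E -> R) x v : inner (egrad f x) v = 'd f x v.
Proof.
have [n [e [eo _ eE]]] := orthonormal_basis fullv.
suff : [set g | forall v, inner g v = 'd f x v] (egrad f x) by exact.
apply: xgetPex; exists (\sum_i 'd f x (e i) *: e i) => w /=.
rewrite [w in RHS]eE ?memvf // linear_sum inner_suml; apply: eq_bigr => i _.
by rewrite innerZl linearZ /= innerC mulrC.
Qed.

End InnerProduct.

(** * The cubic model *)

Section CubicModel.
Context {R : realType} {E : euclideanType R}.

(** The first-order condition at an interior minimum, for a function of t which
    is only known to lie below a quadratic one. At t = - S / (1 + |S| + |K|) the
    linear term would win if S were nonzero. *)
Lemma local_min_slope_eq0 (S K : R) :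
  (forall t : R, `|t| <= 1 -> 0 <= t * S + t ^+ 2 * K) -> S = 0.
Proof.
move=> min0; apply/eqP/negPn/negP => S0.
pose D := 1 + `|S| + `|K|.
have D1 : 1 <= D by rewrite /D -addrA lerDl addr_ge0.
have Dgt0 : 0 < D by rewrite (lt_le_trans ltr01).
have := min0 (- S / D).
rewrite normrM normrN normfV (gtr0_norm Dgt0) ler_pdivrMr // mul1r.
have -> : `|S| <= D by rewrite /D addrC addrA lerDr addr_ge0.
move=> /(_ isT); apply/negP; rewrite -ltNge.
have -> : - S / D * S + (- S / D) ^+ 2 * K = (S / D) ^+ 2 * (K - D).
  by field; rewrite gt_eqF.
rewrite pmulr_rlt0; last first.
  by rewrite lt0r sqr_ge0 sqrf_eq0 mulf_neq0 // invr_eq0 gt_eqF.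
rewrite subr_lt0 (le_lt_trans (ler_norm K)) //.
by rewrite /D ltrDr addrC ltr_wpDl.
Qed.

(** An upper bound of the cube by its expansion in the square, with a remainder
    of second order. It is applied to norms along a line, whose squares are
    polynomials. *)
Lemma cube_increment_le (a b s : R) : 0 <= a -> 0 <= b -> `|b - a| <= s ->
  b ^+ 3 - a ^+ 3 <= 3 / 2 * a * (b ^+ 2 - a ^+ 2) + s ^+ 2 * (b + a / 2).
Proof.
move=> a0 b0 bas.
have -> : b ^+ 3 - a ^+ 3
    = 3 / 2 * a * (b ^+ 2 - a ^+ 2) + (b - a) ^+ 2 * (b + a / 2) by field.
rewrite lerD2l; apply: ler_wpM2r; first by rewrite addr_ge0 // divr_ge0.
by rewrite -[leLHS]real_normK ?num_real // lerXn2r // nnegrE (le_trans _ bas).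
Qed.

Variables (V : {vspace E}) (g d : E) (H : E -> E) (gam : R).

Definition cubic (u : E) : R :=
  inner g u + 2^-1 * inner (H u) u + gam / 6 * `|u| ^+ 3.

Hypothesis H_lin : forall a u w, u \in V -> w \in V ->
  H (a *: u + w) = a *: H u + H w.
Hypothesis H_sym : forall u w, u \in V -> w \in V ->
  inner (H u) w = inner (H w) u.
Hypothesis gam_ge0 : 0 <= gam.
Hypothesis dV : d \in V.
Hypothesis d_min : forall u, u \in V -> cubic d <= cubic u.

(** Along the line d + t w, the model exceeds its value at d by at most
    t S + t^2 K, where S is the left-hand side of the conclusion; minimality
    forces S = 0. *)
Lemma cubic_stationary w : w \in V ->
  inner g w + inner (H d) w + gam / 2 * `|d| * inner d w = 0.
Proof.
move=> wV.
apply: (@local_min_slope_eq0 _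
  (2^-1 * inner (H w) w + gam / 6 * `|w| ^+ 2 * (3 * `|d| + `|w|))) => t t1.
have := d_min (memvD (memvZ t wV) dV); rewrite -subr_ge0 => /le_trans; apply.
pose p := `|t *: w + d|.
have p2 : p ^+ 2 = `|d| ^+ 2 + 2 * t * inner d w + t ^+ 2 * `|w| ^+ 2.
  rewrite /p -!inner_norm innerDl !innerDr !innerZl !innerZr (innerC w d).
  by ring.
have pd : `|p - `|d| | <= `|t| * `|w|.
  by rewrite -normrZ -[X in _ <= `|X|](addrK d) ler_dist_dist.
have p_le : p <= `|w| + `|d|.
  rewrite (le_trans (ler_normD _ _)) // lerD2r normrZ -[leRHS]mul1r.
  exact: ler_wpM2r.
have c3 : p ^+ 3 - `|d| ^+ 3 <= 3 / 2 * `|d| * (p ^+ 2 - `|d| ^+ 2)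
    + t ^+ 2 * `|w| ^+ 2 * (`|w| + `|d| + `|d| / 2).
  apply: le_trans (cube_increment_le (normr_ge0 d) (normr_ge0 _) pd) _.
  rewrite lerD2l exprMn real_normK ?num_real //.
  by rewrite ler_wpM2l ?(mulr_ge0 (sqr_ge0 _) (sqr_ge0 _)) // lerD2r.
have {c3} : gam / 6 * (p ^+ 3 - `|d| ^+ 3) <= gam / 6 *
    (3 / 2 * `|d| * (2 * t * inner d w + t ^+ 2 * `|w| ^+ 2)
      + t ^+ 2 * `|w| ^+ 2 * (`|w| + `|d| + `|d| / 2)).
  rewrite ler_wpM2l ?divr_ge0 //; apply: le_trans c3 _.
  by rewrite p2 le_eqVlt; apply/orP; left; apply/eqP; ring.
rewrite /cubic -/p H_lin // !innerDl !innerDr !innerZl !innerZr (H_sym dV wV).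
by lra.
Qed.

(** The quadratic part is half of <g, d>, which is nonpositive because - d does
    no better than d, plus half of <g, d> + <H d, d>, which stationarity in the
    direction d evaluates to - (gam/2) |d|^3. *)
Lemma cubic_descent : inner g d + 2^-1 * inner (H d) d <= - (gam / 4) * `|d| ^+ 3.
Proof.
have := cubic_stationary dV; rewrite inner_norm.
have HN : H (- d) = - H d.
  have := H_lin (-1) dV (mem0v V); have := H_lin (-1) (mem0v V) (mem0v V).
  rewrite !scaler0 !addr0 scaleN1r !scaleN1r => H0 ->; suff -> : H 0 = 0 by rewrite addr0.
  by rewrite H0 addNr.
have := d_min (_ : - d \in V); rewrite memvN => /(_ dV).
rewrite /cubic HN !innerNr !innerNl opprK normrN.
by lra.
Qed.

(** Stationarity says that the vector g + Proj (H d) + (gam/2) |d| d of V is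
    orthogonal to V. *)
Lemma cubic_residual : g \in V ->
  `|g + oproj [set` V] (H d)| = gam / 2 * `|d| ^+ 2.
Proof.
move=> gV; set P := oproj _ _; have [PV _] := oproj_vspaceP V (H d).
suff /eqP : g + P + (gam / 2 * `|d|) *: d = 0.
  rewrite addr_eq0 => /eqP ->; rewrite normrN normrZ ger0_norm; first by ring.
  by rewrite mulr_ge0 // divr_ge0.
have zV : g + P + (gam / 2 * `|d|) *: d \in V by rewrite !memvD // memvZ.
apply: inner_eq0; rewrite {1}innerDl innerZl innerDl [inner P _]inner_oproj //.
exact: cubic_stationary.
Qed.

End CubicModel.

(** * Differential calculus *)

Section Calculus.
Context {R : realType} {V W : normedModType R}.

Lemma diff_approx (f : V -> W) x : differentiable f x ->
  forall e : R, 0 < e -> exists2 del : R, 0 < del &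
    forall h, `|h| < del -> `|f (x + h) - f x - 'd f x h| <= e * `|h|.
Proof.
move=> df e e0; have [_ /eqaddoP/(_ e e0)] := (diff_locallyP x f).1 df.
move=> /nbhs_normP[del /= del0 H]; exists del => // h hdel.
have := H h; rewrite /= sub0r normrN => /(_ hdel).
by rewrite -![(_ + _) h]/(_ h + _ h) -![(- _) h]/(- _ h) /= opprD addrA (addrC h).
Qed.

(** With [diff_approx], the characterization of differentiability by explicit
    radii, which are combined more easily than little-o terms. *)
Lemma approx_differentiable (f : V -> W) x (df : {linear V -> W}) :
  continuous df ->
  (forall e : R, 0 < e -> exists2 del : R, 0 < del &
    forall h, `|h| < del -> `|f (x + h) - f x - df h| <= e * `|h|) ->
  differentiable f x /\ 'd f x = df :> (V -> W).
Proof.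
move=> dfc H.
have fE : f \o shift x = cst (f x) + df +o_ 0 id.
  apply/eqaddoP => e e0; have [del del0 {}H] := H e e0.
  apply/nbhs_normP; exists del => //= h; rewrite /= sub0r normrN => /H.
  by rewrite -![(_ + _) h]/(_ h + _ h) -![(- _) h]/(- _ h) /= opprD addrA (addrC h).
have dE := diff_unique dfc fE.
by split=> //; apply/diff_locallyP; rewrite dE.
Qed.

Lemma near_eq_differentiable (f g : V -> W) x : (\forall y \near x, f y = g y) ->
  differentiable f x -> differentiable g x.
Proof.
move=> fg df; apply: (proj1 (@approx_differentiable g x ('d f x) _ _)).
  exact: diff_continuous.
move=> e e0; have [del del0 H] := diff_approx df e0.
move/nbhs_normP: fg => [del' /= del'0 H'].
exists (Num.min del del') => [|h]; first by rewrite lt_min del0.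
rewrite lt_min => /andP[hd hd']; rewrite -(H' (x + h)); last first.
  by rewrite /ball_/= opprD addrA subrr sub0r normrN.
rewrite -(H' x); last by rewrite /ball_/= subrr normr0.
exact: H.
Qed.

End Calculus.

Section DirectionalDerivatives.
Context {R : realType} {V : normedModType R}.

Lemma is_diff_translate (f : V -> R) x a : differentiable f (x + a) ->
  is_diff x (fun z => f (z + a)) ('d f (x + a)).
Proof.
move=> df; pose l := fun z : V => z + a.
have dl : is_diff x l id.
  have := is_diffD (is_diff_id x) (is_diff_cst a x); rewrite addr0; exact.
have [dlx dlE] := dl; split; first exact: (differentiable_comp dlx df).
rewrite (_ : (fun z => _) = f \o l) // diff_comp //.
by apply/funext => t /=; rewrite dlE.
Qed.

Lemma MVT_line (f : V -> R) b v :
  (forall s : R, 0 <= s <= 1 -> differentiable f (b + s *: v)) ->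
  exists2 s : R, 0 <= s <= 1 & f (b + v) - f b = 'd f (b + s *: v) v.
Proof.
move=> df; pose phi (s : R) := f (b + s *: v).
pose l := fun s : R => b + s *: v.
have dl (s : R) : is_diff s l ( *:%R ^~ v).
  have := is_diffD (is_diff_cst b s) (is_diff_scalel s v); rewrite add0r; exact.
have dphi (s : R) : 0 <= s <= 1 -> is_derive s 1 phi ('d f (b + s *: v) v).
  move=> s01.
  have [dls dlE] := dl s.
  have dphis : differentiable phi s by apply: (differentiable_comp dls); exact: df.
  apply: DeriveDef; first exact: diff_derivable.
  rewrite deriveE // (_ : phi = f \o l) // diff_comp //=; last exact: df.
  by rewrite dlE scale1r.
have [|s|s s01 sE] := @MVT_segment R phi (fun s => 'd f (b + s *: v) v) 0 1 ler01.
- by move=> s; rewrite in_itv /= => /andP[s0 s1]; apply: dphi; rewrite !ltW.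
- apply: continuous_in_subspaceT => t; rewrite inE /= in_itv /= => t01.
  by apply/differentiable_continuous/derivable1_diffP; case: (dphi _ t01).
exists s; first by move: s01; rewrite in_itv.
by move: sE; rewrite /phi scale1r scale0r addr0 subr0 mulr1.
Qed.

(** Apply the mean value theorem in the direction v to
    F z = f (z + t w) - f z: the second difference is t times an increment of
    ['D_v f], which is estimated by the differential of ['D_v f] at x. *)
Lemma second_difference_approx (f : V -> R) x v w :
  (\forall y \near x, differentiable f y) -> differentiable ('D_v f) x ->
  forall e : R, 0 < e -> exists2 del : R, 0 < del & forall t : R, 0 < t -> t < del ->
  `|f (x + t *: v + t *: w) - f (x + t *: v) - f (x + t *: w) + f x
     - t ^+ 2 * 'D_w ('D_v f) x| <= e * t ^+ 2.
Proof.
move=> df dg e e0; set g := 'D_v f.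
pose c := `|v| + `|w| + 1.
have c0 : 0 < c by rewrite ltr_wpDl // addr_ge0.
move/nbhs_normP: df => [r /= r0 fr].
have [del del0 H] : exists2 del : R, 0 < del & forall h, `|h| < del ->
    `|g (x + h) - g x - 'd g x h| <= e / (2 * c) * `|h|.
  by apply: diff_approx; rewrite // divr_gt0 // mulr_gt0.
exists (Num.min r del / c) => [|t t0]; first by rewrite divr_gt0 // lt_min r0.
rewrite ltr_pdivlMr // lt_min => /andP[tr td].
have small (s b : R) : 0 <= s <= 1 -> 0 <= b <= 1 ->
    `|(s * t) *: v + (b * t) *: w| <= t * c.
  move=> /andP[s0 s1] /andP[b0 b1].
  rewrite (le_trans (ler_normD _ _)) // !normrZ !ger0_norm ?mulr_ge0 ?(ltW t0) //.
  rewrite /c mulrDr mulr1 -[leLHS]addr0 lerD ?(ltW t0) // mulrDr.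
  by rewrite lerD // ler_wpM2r // ler_piMl // ltW.
have fdiff (s b : R) : 0 <= s <= 1 -> 0 <= b <= 1 ->
    differentiable f (x + ((s * t) *: v + (b * t) *: w)).
  move=> s01 b01; apply: fr => /=.
  by rewrite opprD addrA subrr sub0r normrN (le_lt_trans (small _ _ s01 b01)).
have i1 : 0 <= (1 : R) <= 1 by rewrite ler01 lexx.
have i0 : 0 <= (0 : R) <= 1 by rewrite ler01 lexx.
pose F z := f (z + t *: w) - f z.
have Fdiff (s : R) : 0 <= s <= 1 -> is_diff (x + s *: (t *: v)) F
   (fun h => 'd f (x + s *: (t *: v) + t *: w) h - 'd f (x + s *: (t *: v)) h).
  move=> s01; rewrite /F.
  have d1 : differentiable f (x + s *: (t *: v) + t *: w).
    by have := fdiff _ _ s01 i1; rewrite scalerA mul1r addrA.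
  have d2 : differentiable f (x + s *: (t *: v)).
    by have := fdiff _ _ s01 i0; rewrite scalerA mul0r scale0r addr0.
  have t1 := is_diff_translate d1; have t2 := differentiableP d2.
  exact: (is_diffB (f := fun z => f (z + t *: w)) (g := f)).
have [s s01|s s01 sE] := @MVT_line F x (t *: v).
  by have [] := Fdiff s s01.
have [_ dFE] := Fdiff _ s01.
have {}sE : f (x + t *: v + t *: w) - f (x + t *: v) - f (x + t *: w) + f x
    = t * (g (x + ((s * t) *: v + t *: w)) - g (x + (s * t) *: v)).
  transitivity (F (x + t *: v) - F x); first rewrite /F.
    move: (f (x + t *: v + t *: w)) (f (x + t *: v)) (f (x + t *: w)) (f x).
    by move=> *; ring.
  rewrite sE dFE /= !scalerA !linearZ /= /g !deriveE ?addrA //.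
  - by rewrite scalerN mulrBr.
  - by have := fdiff _ _ s01 i0; rewrite mul0r scale0r addr0.
  - by have := fdiff _ _ s01 i1; rewrite mul1r addrA.
have h1 : `|(s * t) *: v + t *: w| <= t * c.
  by have := small _ _ s01 i1; rewrite mul1r.
have h2 : `|(s * t) *: v| <= t * c.
  by have := small _ _ s01 i0; rewrite mul0r scale0r addr0.
have dgv (a : R) : 'd g x (a *: v) = a * 'D_v g x by rewrite linearZ deriveE.
have dgw (a : R) : 'd g x (a *: w) = a * 'D_w g x by rewrite linearZ deriveE.
have := H _ (le_lt_trans h1 td); have := H _ (le_lt_trans h2 td).
rewrite linearD dgv dgw sE => H2 H1.
have ec : e / (2 * c) * (t * c) = e * t / 2 by field; rewrite gt_eqF.
have e2 : 0 <= e / (2 * c) by rewrite divr_ge0 ?mulr_ge0 ?(ltW c0) ?(ltW e0).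
have {}H1 := le_trans H1 (ler_wpM2l e2 h1).
have {}H2 := le_trans H2 (ler_wpM2l e2 h2).
rewrite ec in H1 H2.
move: H1 H2.
move: (g (x + ((s * t) *: v + t *: w))) (g (x + (s * t) *: v)) => G1 G2.
move: (g x) ('D_v g x) ('D_w g x) => G0 A B H1 H2.
have -> : t * (G1 - G2) - t ^+ 2 * B
    = t * ((G1 - G0 - (s * t * A + t * B)) - (G2 - G0 - s * t * A)) by ring.
rewrite normrM (gtr0_norm t0) expr2 mulrCA ler_pM2l //.
apply: le_trans (ler_normB _ _) _.
by rewrite [e * t]splitr lerD.
Qed.

(** The second difference does not depend on the order of v and w, and
    [second_difference_approx] approximates it by t^2 times either mixed
    derivative. *)
Lemma young (f : V -> R) x v w : (\forall y \near x, differentiable f y) ->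
  differentiable ('D_v f) x -> differentiable ('D_w f) x ->
  'D_w ('D_v f) x = 'D_v ('D_w f) x.
Proof.
move=> df dv dw; apply/eqP; rewrite -subr_eq0 -normr_le0; apply/ler_addgt0Pl => e e0.
rewrite addr0; have e2 : 0 < e / 2 by rewrite divr_gt0.
have [d1 d10 H1] := second_difference_approx w df dv e2.
have [d2 d20 H2] := second_difference_approx v df dw e2.
pose t := Num.min d1 d2 / 2.
have m0 : 0 < Num.min d1 d2 by rewrite lt_min d10.
have t0 : 0 < t by rewrite divr_gt0.
have : t < Num.min d1 d2 by rewrite ltr_pdivrMr // ltr_pMr // ltr1n.
rewrite lt_min => /andP[/(H1 _ t0) {}H1 /(H2 _ t0)].
rewrite (addrAC x (t *: w)) [X in `|X + _ - _|]addrAC => {}H2.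
have t2 : 0 < t ^+ 2 by rewrite exprn_gt0.
rewrite -(ler_pM2l t2) -[X in X * `|_|](gtr0_norm t2) -normrM.
rewrite (_ : t ^+ 2 * e = e / 2 * t ^+ 2 + e / 2 * t ^+ 2); last by field.
rewrite distrC in H1.
apply: le_trans (lerD H1 H2); apply: le_trans (ler_normD _ _).
rewrite le_eqVlt; apply/orP; left; apply/eqP; congr `|_|.
by move: ('D_w _ _) ('D_v _ _) (f _) (f _) (f _) => *; ring.
Qed.

End DirectionalDerivatives.

Section BigSum.
Context {R : realType} {V W : normedModType R}.

Lemma differentiable_bigsum (I : Type) (r : seq I) (P : pred I) (F : I -> V -> W) x :
  (forall i, differentiable (F i) x) ->
  differentiable (fun y => \sum_(i <- r | P i) F i y) x.
Proof.
move=> dF; elim: r => [|a r IH].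
  by under eq_fun do rewrite big_nil; exact: differentiable_cst.
under eq_fun do rewrite big_cons; case: (P a) => //.
exact: (differentiableD (dF a) IH).
Qed.

End BigSum.

Section Determinant.
Context {R : realType} {V : normedModType R}.

Lemma differentiable_mul (f g : V -> R) x : differentiable f x ->
  differentiable g x -> differentiable (fun y => f y * g y) x.
Proof. exact: differentiableM. Qed.

Lemma differentiable_bigsumr (I : Type) (r : seq I) (P : pred I) (F : I -> V -> R) x :
  (forall i, differentiable (F i) x) ->
  differentiable (fun y => \sum_(i <- r | P i) F i y) x.
Proof. exact: differentiable_bigsum. Qed.

Lemma differentiable_bigprod (I : Type) (r : seq I) (P : pred I) (F : I -> V -> R) x :
  (forall i, differentiable (F i) x) ->
  differentiable (fun y => \prod_(i <- r | P i) F i y) x.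
Proof.
move=> dF; elim: r => [|a r IH].
  by under eq_fun do rewrite big_nil; exact: differentiable_cst.
under eq_fun do rewrite big_cons; case: (P a) => //.
exact: (differentiableM (dF a) IH).
Qed.

Lemma differentiable_det n (A : V -> 'M[R]_n) x :
  (forall i j, differentiable (fun y => A y i j) x) ->
  differentiable (fun y => \det (A y)) x.
Proof.
move=> dA; apply: differentiable_bigsumr => s.
apply: (@differentiable_mul (fun=> (-1) ^+ perm.odd_perm s)); first exact: differentiable_cst.
by apply: differentiable_bigprod => i.
Qed.

(** The inverse is the adjugate divided by the determinant near x. *)
Lemma differentiable_invmx n (A : V -> 'M[R]_n) x i j :
  (forall i j, differentiable (fun y => A y i j) x) -> A x \in unitmx ->
  differentiable (fun y => invmx (A y) i j) x.
Proof.
move=> dA uA; have ddet := differentiable_det dA.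
have det0 : \det (A x) != 0 by rewrite -unitfE.
apply: (@near_eq_differentiable _ _ _
    (fun y => (\det (A y))^-1 * (\adj (A y)) i j)).
  have near0 : \forall y \near x, \det (A y) != 0.
    exact: (cvgr_neq0 _ (differentiable_continuous ddet) det0).
  move: near0; apply: filterS => y dy.
  by rewrite /invmx unitmxE unitfE dy [RHS]mxE.
apply: (@differentiable_mul (fun y => (\det (A y))^-1)).
  exact: (differentiableV ddet det0).
under eq_fun do rewrite mxE /cofactor.
apply: (@differentiable_mul (fun=> (-1) ^+ (j + i))).
  exact: differentiable_cst.
apply: differentiable_det => k l; under eq_fun do rewrite !mxE.
exact: dA.
Qed.

End Determinant.

(** * Strict differentiability *)

(* Makes row vectors a complete normed module, as Banach's fixed point theorem
   requires. *)
HB.instance Definition _ (R : realType) (k : nat) := Complete.on 'rV[R]_k.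
HB.saturate matrix.

Section StrictDifferentiability.
Context {R : realType} {E : euclideanType R}.

Lemma common_radius (I : finType) (P : I -> R -> Prop) :
  (forall i d d', P i d -> d' <= d -> P i d') ->
  (forall i, exists2 d, 0 < d & P i d) ->
  exists2 d : R, 0 < d & forall i, P i d.
Proof.
move=> mono /(_ _)/cid2-/all_sig[r rP]; exists (\big[Num.min/1]_i r i).
  by apply: lt_bigmin => // i _; case: (rP i).
by move=> i; apply: (mono _ (r i)); [case: (rP i)|exact: bigmin_le].
Qed.

Lemma orthonormal_norm_sum n (e : 'I_n -> E) (v : E) : orthonormal_family e ->
  \sum_i `|inner v (e i)| <= n%:R * `|v|.
Proof.
move=> eo; rewrite -[n in n%:R]card_ord mulr_natl -sumr_const; apply: ler_sum => i _.
apply: le_trans (cauchy_schwarz _ _) _.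
suff -> : `|e i| = 1 by rewrite mulr1.
by apply/eqP; rewrite -[_ == 1](@eqrXn2 _ 2) // -inner_norm eo eqxx expr1n.
Qed.

(** Weaker than [class_C 2]: the differentiability of the first derivatives
    makes them continuous, as strict differentiability requires, and suffices for
    the symmetry of the second ones. *)
Definition C2_on (U : set E) (f : E -> R) : Prop :=
  [/\ open U, forall x, U x -> differentiable f x &
      forall v x, U x -> differentiable ('D_v f) x].

Lemma class_C2_on (U : set E) (f : E -> R) : open U -> class_C 2 U f -> C2_on U f.
Proof. by move=> oU [df dDf]; split=> // v; case: (dDf v). Qed.

Lemma open_ball_sub (U : set E) y : open U -> U y ->
  exists2 r : R, 0 < r & forall z, `|z - y| < r -> U z.
Proof.
move=> oU Uy; have /nbhs_normP[r /= r0 H] := open_nbhs_nbhs (conj oU Uy).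
by exists r => // z zr; apply: H; rewrite /= distrC.
Qed.

(** The mean value theorem reduces the increment f a - f b to a directional
    derivative at a point near y; in an orthonormal basis it is a combination of
    finitely many partial derivatives, which are continuous at y. *)
Lemma strict_diff (U : set E) (f : E -> R) y : C2_on U f -> U y ->
  forall e : R, 0 < e -> exists2 del : R, 0 < del & forall a b,
    `|a - y| < del -> `|b - y| < del ->
    `|f a - f b - 'd f y (a - b)| <= e * `|a - b|.
Proof.
move=> [oU df dDf] Uy e e0.
have [n [ba [bo _ bE]]] := orthonormal_basis (fullv : {vspace E}).
have n0 : 0 < n%:R + 1 :> R by rewrite ltr_wpDl.
have [r r0 rU] := open_ball_sub oU Uy.
have [|i|rho rho0 rhoP] := @common_radius 'I_n (fun i d => forall z, `|z - y| < d ->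
    `|'D_(ba i) f z - 'D_(ba i) f y| <= e / (n%:R + 1)).
- by move=> i d d' H dd' z zd; apply: H; exact: lt_le_trans dd'.
- have /differentiable_continuous/cvgrPdist_le := dDf (ba i) _ Uy.
  move=> /(_ _ (divr_gt0 e0 n0))/nbhs_normP[d /= d0 H]; exists d => // z zd.
  by rewrite distrC; apply: H; rewrite /= distrC.
exists (Num.min r rho) => [|a b]; first by rewrite lt_min r0.
move=> ay bY; have seg (s : R) : 0 <= s <= 1 -> `|b + s *: (a - b) - y| < Num.min r rho.
  move=> /andP[s0 s1].
  have -> : b + s *: (a - b) - y = (1 - s) *: (b - y) + s *: (a - y).
    have -> : a - b = (a - y) - (b - y) by rewrite opprB addrA subrK.
    by rewrite scalerBr scalerBl scale1r addrAC addrA [LHS]addrAC.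
  rewrite (le_lt_trans (ler_normD _ _)) // !normrZ !ger0_norm ?subr_ge0 //.
  have [->|sn0] := eqVneq s 0; first by rewrite subr0 mul1r mul0r addr0.
  rewrite [ltRHS](_ : _ = (1 - s) * Num.min r rho + s * Num.min r rho); last by ring.
  apply: ler_ltD; first by rewrite ler_wpM2l ?subr_ge0 // ltW.
  by rewrite ltr_pM2l // lt_def sn0.
have [s s01|s s01] := @MVT_line _ _ f b (a - b).
  by apply: df; apply: rU; have := seg s s01; rewrite lt_min => /andP[].
rewrite (addrC b (a - b)) subrK => ->.
have := seg s s01; move: (b + _) => z; rewrite lt_min => /andP[zr zrho].
have dfE u : 'd f u (a - b) = \sum_i inner (a - b) (ba i) * 'd f u (ba i).
  rewrite [X in 'd f u X](bE (a - b)) ?memvf // linear_sum.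
  by apply: eq_bigr => i _; rewrite linearZ.
rewrite !dfE -sumrB.
apply: le_trans (ler_norm_sum _ _ _) _.
apply: (@le_trans _ _ (\sum_i e / (n%:R + 1) * `|inner (a - b) (ba i)|)).
  apply: ler_sum => i _; rewrite -mulrBr normrM mulrC ler_wpM2r //.
  by rewrite -!deriveE; [exact: rhoP|exact: df|apply: df; exact: rU].
rewrite -mulr_sumr -mulrA ler_pM2l //.
rewrite ler_pdivrMl //; apply: le_trans (orthonormal_norm_sum _ bo) _.
by rewrite ler_wpM2r // lerDl.
Qed.

Lemma norm_coord k (s : 'rV[R]_k) i : `|s 0 i| <= `|s|.
Proof. by rewrite [leRHS]mx_normrE; exact: (le_bigmax _ _ (0, i)). Qed.

Lemma norm_rV_le k (s : 'rV[R]_k) (c : R) : 0 <= c ->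
  (forall i, `|s 0 i| <= c) -> `|s| <= c.
Proof.
move=> c0 H; rewrite [leLHS]mx_normrE; apply: bigmax_le => // -[i j] _ /=.
by rewrite (ord1 i).
Qed.

Lemma coord_diff k (h : E -> 'rV[R]_k) y v i : differentiable h y ->
  'd (fun z => h z 0 i) y v = 'd h y v 0 i.
Proof.
move=> dh; have dhi : differentiable (fun z => h z 0 i : R) y.
  exact: (differentiable_comp dh (differentiable_coord _ _ _)).
by rewrite -!deriveE // derive_mx ?mxE //; exact: diff_derivable.
Qed.

Lemma strict_diff_rV k (U : set E) (h : E -> 'rV[R]_k) y :
  (forall z, U z -> differentiable h z) ->
  (forall i, C2_on U (fun z => h z 0 i)) -> U y ->
  forall e : R, 0 < e -> exists2 del : R, 0 < del & forall a b,
    `|a - y| < del -> `|b - y| < del ->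
    `|h a - h b - 'd h y (a - b)| <= e * `|a - b|.
Proof.
move=> dh C2 Uy e e0.
have [|i|del del0 H] := @common_radius 'I_k (fun i d => forall a b,
    `|a - y| < d -> `|b - y| < d ->
    `|h a 0 i - h b 0 i - 'd (fun z => h z 0 i) y (a - b)| <= e * `|a - b|).
- move=> i d d' H dd' a b ad bd.
  by apply: H; [exact: lt_le_trans ad dd'|exact: lt_le_trans bd dd'].
- exact: strict_diff (C2 i) Uy e e0.
exists del => // a b ad bd; apply: norm_rV_le => [|i]; first by rewrite mulr_ge0 // ltW.
by have := H i a b ad bd; rewrite coord_diff ?mxE //; exact: dh.
Qed.

End StrictDifferentiability.

(** * Solving the constraint *)

Section ConstraintCurve.
Context {R : realType} {E : euclideanType R} (k : nat).
Variables (U : set E) (h : E -> 'rV[R]_k) (y : E).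
Hypothesis U_open : open U.
Hypothesis Uy : U y.
Hypothesis h_diff : forall z, U z -> differentiable h z.
Hypothesis h_C2 : forall i, C2_on U (fun z => h z 0 i).
Variables (A : {linear 'rV[R]_k -> E}) (a : R).
Hypothesis a_ge0 : 0 <= a.
Hypothesis A_bound : forall s, `|A s| <= a * `|s|.
Hypothesis A_inv : forall s, 'd h y (A s) = s.
Hypothesis hy0 : h y = 0.

(** The corrections s that put p + A s on the zero set of h are the fixed points
    of s |-> s - h (p + A s). By strict differentiability at y this map is a
    contraction of ratio 1/2, since A is a right inverse of ['d h y]; hence it
    stabilizes the closed ball of radius 2 |h p|. *)
Lemma solve_constraint : exists2 del : R, 0 < del & forall p, `|p - y| < del ->
  exists s, [/\ U (p + A s), h (p + A s) = 0 & `|s| <= 2 * `|h p|].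
Proof.
have [r r0 rU] := open_ball_sub U_open Uy.
have a1 : 0 < a + 1 by rewrite ltr_wpDl.
have e0 : 0 < (2 * (a + 1))^-1 by rewrite invr_gt0 mulr_gt0.
have [d1 d10 strict] := strict_diff_rV h_diff h_C2 Uy e0.
pose d0 := Num.min r d1; have d00 : 0 < d0 by rewrite lt_min r0.
have /differentiable_continuous/cvgrPdist_le := h_diff Uy.
have q0 : 0 < d0 / (4 * (a + 1)) by rewrite divr_gt0 // mulr_gt0.
move=> /(_ _ q0)/nbhs_normP[d2 /= d20 cont].
exists (Num.min (d0 / 2) d2) => [|p]; first by rewrite lt_min divr_gt0.
rewrite lt_min => /andP[py pd2].
have hp : `|h p| <= d0 / (4 * (a + 1)).
  by have := cont p; rewrite /= distrC pd2 hy0 sub0r normrN; apply.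
pose rho := 2 * `|h p|.
pose S := [set s : 'rV[R]_k | `|s| <= rho].
have inball s : S s -> `|p + A s - y| < d0.
  move=> Ss; rewrite addrAC (le_lt_trans (ler_normD _ _)) //.
  rewrite [ltRHS]splitr ltr_leD // (le_trans (A_bound s)) //.
  apply: (@le_trans _ _ ((a + 1) * (2 * (d0 / (4 * (a + 1)))))).
    apply: ler_pM => //; first by rewrite lerDl.
    by rewrite (le_trans Ss) // /rho ler_pM2l.
  by rewrite le_eqVlt; apply/orP; left; apply/eqP; field; rewrite gt_eqF.
pose Phi s := s - h (p + A s).
have lip s s' : S s -> S s' -> `|Phi s - Phi s'| <= 2^-1 * `|s - s'|.
  move=> /inball; rewrite lt_min => /andP[_ Ss] /inball; rewrite lt_min => /andP[_ Ss'].
  have := strict _ _ Ss Ss'.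
  rewrite opprD addrACA subrr add0r -linearB A_inv distrC.
  have -> : s - s' - (h (p + A s) - h (p + A s')) = Phi s - Phi s'.
    by rewrite /Phi !opprB [LHS]addrACA [RHS]addrACA [- s' - _]addrC.
  move/le_trans; apply; apply: le_trans (ler_wpM2l (ltW e0) (A_bound _)) _.
  rewrite mulrA ler_wpM2r // invfM -mulrA ler_piMr ?invr_ge0 //.
  by rewrite ler_pdivrMl // mulr1 lerDl.
(* |Phi s| <= |Phi s - Phi 0| + |Phi 0| <= |s| / 2 + |h p|. *)
have homo s : S s -> S (Phi s).
  move=> Ss; have S0 : S 0 by rewrite /S /= normr0 mulr_ge0.
  have Phi0 : `|Phi 0| = `|h p| by rewrite /Phi linear0 addr0 sub0r normrN.
  rewrite /S /= -(subrK (Phi 0) (Phi s)) (le_trans (ler_normD _ _)) // Phi0.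
  rewrite /rho [2 * _]mulr_natl mulr2n lerD2r (le_trans (lip _ _ Ss S0)) //.
  by rewrite subr0 ler_pdivrMl.
have homo' : {homo Phi : s / S s >-> S s} by [].
have ctr : is_contraction (mkfun_fun homo').
  exists (2^-1)%:nng; split => /=; first by rewrite invf_lt1 // ltr1n.
  by move=> [s s'] [/= Ss Ss']; exact: lip.
have Scl : closed S.
  have -> : S = (fun s : 'rV[R]_k => `|s|) @^-1` [set z | z <= rho] by [].
  apply: closed_comp (@closed_le _ _) => s _; exact: norm_continuous.
have [|s Ss sE] := banach_fixed_point ctr Scl.
  by exists 0; rewrite /S /= normr0 mulr_ge0.
exists s; split => //.
  by apply: rU; have := inball s Ss; rewrite lt_min => /andP[].
move: sE; rewrite /= /mkfun /Phi => /eqP.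
by rewrite -[X in X == _]subr0 => /eqP/addrI/oppr_inj.
Qed.

(** Correct y + t v by [solve_constraint]. The correction has norm at most a
    constant times |h (y + t v)|, which is o(t) because ['d h y v = 0]; so the
    velocity of the curve at 0 is v. *)
Lemma constraint_curve v : 'd h y v = 0 ->
  exists c : R -> E, [/\ c 0 = y,
    \forall t \near (0 : R), U (c t) /\ h (c t) = 0 & is_derive (0 : R) 1 c v].
Proof.
move=> dv0; have [del del0 solve] := solve_constraint.
have [S HS] : {S : E -> 'rV[R]_k & forall p, `|p - y| < del ->
    [/\ U (p + A (S p)), h (p + A (S p)) = 0 & `|S p| <= 2 * `|h p|]}.
  apply: (@choice _ _ (fun p s => `|p - y| < del ->
    [/\ U (p + A s), h (p + A s) = 0 & `|s| <= 2 * `|h p|])) => p.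
  have [/solve[s sP]|pd] := pselect (`|p - y| < del); first by exists s.
  by exists 0.
pose c (t : R) := y + t *: v + A (S (y + t *: v)).
have lin t : `|t| * (`|v| + 1) < del -> `|y + t *: v - y| < del.
  rewrite addrAC subrr add0r normrZ => /(le_lt_trans _); apply.
  by rewrite ler_wpM2l // lerDl.
have v1 : 0 < `|v| + 1 by rewrite ltr_wpDl.
have Sy : S y = 0.
  have [|_ _] := HS y; first by rewrite subrr normr0.
  by rewrite hy0 normr0 mulr0 normr_le0 => /eqP.
have c0 : c 0 = y by rewrite /c scale0r addr0 Sy linear0 addr0.
exists c; split => //.
  apply/nbhs_normP; exists (del / (`|v| + 1)) => /=; first by rewrite divr_gt0.
  move=> t; rewrite /= sub0r normrN ltr_pdivlMr // => /lin/HS[].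
  by split.
have [cd cE] : differentiable c (0 : R) /\ 'd c (0 : R) = ( *:%R^~ v) :> (R -> E).
  have lin_v : linear ( *:%R ^~ v : R -> E).
    by move=> u z w; rewrite scalerDl scalerA.
  pose dfM := GRing.isLinear.Build _ _ _ _ _ lin_v.
  pose df : {linear R -> E} := HB.pack ( *:%R ^~ v) dfM.
  apply: (@approx_differentiable _ _ _ _ _ df); first exact: scalel_continuous.
  move=> e e0; have a1 : 0 < 2 * (a + 1) * (`|v| + 1).
    by rewrite !mulr_gt0 // ltr_wpDl.
  have [d1 d10 H] := diff_approx (h_diff Uy) (divr_gt0 e0 a1).
  exists (Num.min del d1 / (`|v| + 1)) => [|t]; first by rewrite divr_gt0 // lt_min del0.
  rewrite ltr_pdivlMr // lt_min => /andP[/lin/HS[_ _ tdel] td1].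
  have tv : `|t *: v| <= `|t| * (`|v| + 1) by rewrite normrZ ler_wpM2l // lerDl.
  rewrite add0r c0 /c addrC.
  have := H _ (le_lt_trans tv td1).
  have -> : 'd h y (t *: v) = 0 by rewrite linearZ /= dv0 scaler0.
  rewrite hy0 !subr0 => hb.
  have -> : - (t *: v) + (y + t *: v + A (S (y + t *: v)) - y) = A (S (y + t *: v)).
    by rewrite addrC addrAC -addrA -opprD [t *: v + y]addrC addrC addKr.
  apply: le_trans (A_bound _) _; apply: le_trans (ler_wpM2l a_ge0 tdel) _.
  apply: le_trans (_ : (a + 1) * (2 * `|h (y + t *: v)|) <= _).
    by rewrite ler_wpM2r ?mulr_ge0 // lerDl.
  have {tv}hb := le_trans hb (ler_wpM2l (divr_ge0 (ltW e0) (ltW a1)) tv).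
  have a2 : 0 <= (a + 1) * 2 by rewrite mulr_ge0 // addr_ge0.
  rewrite mulrA (le_trans (ler_wpM2l a2 hb)) // le_eqVlt; apply/orP; left; apply/eqP.
  by field; rewrite !gt_eqF // ltr_wpDl.
by apply: DeriveDef; [exact: diff_derivable|rewrite deriveE // cE scale1r].
Qed.

End ConstraintCurve.

(** * The Riemannian gradient and Hessian in a chart *)

Section GradientCalculus.
Context {R : realType} {E : euclideanType R}.

Lemma differentiable_inner (F G : E -> E) x : differentiable F x ->
  differentiable G x -> differentiable (fun z => inner (F z) (G z)) x.
Proof.
move=> dF dG; have [n [e [eo _ eE]]] := orthonormal_basis (fullv : {vspace E}).
have coord (H : E -> E) i : differentiable H x ->
    differentiable (fun z => inner (H z) (e i)) x.
  move=> dH; apply: (differentiable_comp (g := innerr (e i)) dH).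
  by apply: linear_differentiable; exact: innerr_continuous.
have -> : (fun z => inner (F z) (G z)) =
    (fun z => \sum_i inner (F z) (e i) * inner (G z) (e i)).
  apply/funext => z; rewrite [F z in LHS]eE ?memvf // inner_suml.
  by apply: eq_bigr => i _; rewrite innerZl (innerC (e i)).
by apply: differentiable_bigsumr => i; apply: differentiable_mul; exact: coord.
Qed.

Lemma differentiable_egrad (U : set E) (f : E -> R) x : C2_on U f -> U x ->
  differentiable (egrad f) x.
Proof.
move=> [oU df dDf] Ux.
have [n [e [eo _ eE]]] := orthonormal_basis (fullv : {vspace E}).
apply: (@near_eq_differentiable _ _ _ (fun z => \sum_i 'D_(e i) f z *: e i)).
  apply: filterS (open_nbhs_nbhs (conj oU Ux)) => z Uz.
  rewrite [RHS]eE ?memvf //; apply: eq_bigr => i _.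
  by rewrite egradP deriveE //; exact: df.
apply: differentiable_bigsum => i.
exact: (differentiableZl (e i) (dDf (e i) x Ux)).
Qed.

Lemma differentiable_scale (c : E -> R) (F : E -> E) x : differentiable c x ->
  differentiable F x -> differentiable (fun z => c z *: F z) x.
Proof.
move=> dc dF; have [n [e [eo _ eE]]] := orthonormal_basis (fullv : {vspace E}).
have -> : (fun z => c z *: F z) =
    (fun z => \sum_i (c z * inner (F z) (e i)) *: e i).
  apply/funext => z; rewrite [F z in LHS]eE ?memvf // scaler_sumr.
  by apply: eq_bigr => i _; rewrite scalerA.
apply: differentiable_bigsum => i.
apply: (differentiableZl (k := fun z => c z * inner (F z) (e i))).
apply: differentiable_mul => //; apply: (differentiable_inner dF).
exact: differentiable_cst.
Qed.

End GradientCalculus.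

Section Chart.
Context {R : realType} {E : euclideanType R} (k : nat).
Variables (U : set E) (h : E -> 'rV[R]_k).
Hypothesis U_open : open U.
Hypothesis h_diff : forall z, U z -> differentiable h z.
Hypothesis h_C2 : forall i, C2_on U (fun z => h z 0 i).

Definition normal (i : 'I_k) : E -> E := egrad (fun z => h z 0 i).

Lemma inner_normal i z v : U z -> inner (normal i z) v = 'd h z v 0 i.
Proof. by move=> Uz; rewrite egradP coord_diff //; exact: h_diff. Qed.

Definition gram (z : E) : 'M[R]_k := \matrix_(i, j) inner (normal i z) (normal j z).

(** The coefficients of the normal part of F z in the family of normals, as the
    solution of the normal equations. *)
Definition normal_coef (F : E -> E) (z : E) : 'rV[R]_k :=
  (\row_j inner (normal j z) (F z)) *m invmx (gram z).

Definition tangential (F : E -> E) (z : E) : E :=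
  F z - \sum_i normal_coef F z 0 i *: normal i z.

Lemma differentiable_gram i j z : U z -> differentiable (fun y => gram y i j) z.
Proof.
move=> Uz; under eq_fun do rewrite mxE.
by apply: differentiable_inner; apply: differentiable_egrad (h_C2 _) Uz.
Qed.

(** A vector u in the kernel of the Gram matrix gives a combination of the
    normals orthogonal to all of them, so zero. Testing it against some v with
    ['d h z v = u] gives |u|^2 = 0. *)
Lemma gram_unit z : U z -> (forall w, exists v, 'd h z v = w) -> gram z \in unitmx.
Proof.
move=> Uz surj; rewrite -row_free_unit -kermx_eq0; apply/rowV0P => u /sub_kermxP uG.
pose n := \sum_i u 0 i *: normal i z.
have nn i : inner n (normal i z) = 0.
  have := congr1 (fun s : 'rV_k => s 0 i) uG; rewrite !mxE => <-.
  by rewrite inner_suml; apply: eq_bigr => j _; rewrite innerZl mxE.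
have n0 : n = 0.
  apply: inner_eq0; rewrite {1}/n inner_suml big1 // => i _.
  by rewrite innerZl innerC nn mulr0.
have [v dv] := surj u.
have : inner n v = \sum_i u 0 i ^+ 2.
  rewrite inner_suml; apply: eq_bigr => i _.
  by rewrite innerZl inner_normal // dv expr2.
rewrite n0 inner0l => /esym/eqP; rewrite psumr_eq0 => [|i _]; last exact: sqr_ge0.
move=> /allP u0; apply/rowP => i; rewrite mxE; apply/eqP.
by have := u0 i (mem_index_enum _); rewrite /= sqrf_eq0.
Qed.

Lemma near_gram_unit z : U z -> gram z \in unitmx ->
  \forall y \near z, gram y \in unitmx.
Proof.
move=> Uz; rewrite unitmxE unitfE => det0.
have ddet : differentiable (fun y => \det (gram y)) z.
  by apply: differentiable_det => i j; exact: differentiable_gram.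
have : \forall y \near z, \det (gram y) != 0.
  exact: (cvgr_neq0 _ (differentiable_continuous ddet) det0).
by apply: filterS => y; rewrite unitmxE unitfE.
Qed.

(** The right inverse of ['d h z] with values in the normal space. *)
Definition normal_comb (z : E) (s : 'rV[R]_k) : E :=
  \sum_i (s *m invmx (gram z)) 0 i *: normal i z.

Lemma normal_comb_is_linear z : linear (normal_comb z).
Proof.
move=> a s t; rewrite /normal_comb scaler_sumr -big_split /=.
by apply: eq_bigr => i _; rewrite mulmxDl -scalemxAl !mxE scalerDl scalerA.
Qed.

HB.instance Definition _ z :=
  GRing.isLinear.Build R 'rV[R]_k E *:%R (normal_comb z) (normal_comb_is_linear z).

Lemma diff_normal_comb z s : U z -> gram z \in unitmx ->
  'd h z (normal_comb z s) = s.
Proof.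
move=> Uz uG; apply/rowP => j; rewrite -inner_normal // innerC inner_suml.
transitivity ((s *m invmx (gram z) *m gram z) 0 j); last by rewrite mulmxKV.
by rewrite [RHS]mxE; apply: eq_bigr => i _; rewrite innerZl [gram z i j]mxE.
Qed.

Lemma normal_comb_bound z : exists2 a : R, 0 <= a &
  forall s, `|normal_comb z s| <= a * `|s|.
Proof.
exists (\sum_i (\sum_j `|invmx (gram z) j i|) * `|normal i z|).
  by apply: sumr_ge0 => i _; rewrite mulr_ge0 // sumr_ge0.
move=> s; apply: le_trans (ler_norm_sum _ _ _) _; rewrite mulr_suml.
apply: ler_sum => i _; rewrite normrZ mulrAC ler_wpM2r // mxE.
apply: le_trans (ler_norm_sum _ _ _) _; rewrite mulr_suml.
by apply: ler_sum => j _; rewrite normrM mulrC ler_wpM2l // norm_coord.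
Qed.

Lemma inner_tangential F z w : 'd h z w = 0 -> U z ->
  inner (tangential F z) w = inner (F z) w.
Proof.
move=> dw0 Uz; rewrite innerBl inner_suml big1 ?subr0 // => i _.
by rewrite innerZl inner_normal // dw0 [X in _ * X]mxE mulr0.
Qed.

Lemma diff_tangential F z : U z -> gram z \in unitmx -> 'd h z (tangential F z) = 0.
Proof.
move=> Uz uG; rewrite linearB -[\sum_i _]/(normal_comb z _) diff_normal_comb //.
by apply/rowP => j; rewrite !mxE -inner_normal // subrr.
Qed.

Lemma oproj_ker F z : U z -> gram z \in unitmx ->
  oproj [set` lker (linfun ('d h z))] (F z) = tangential F z.
Proof.
move=> Uz uG; apply: oproj_eq => [|w]; rewrite memv_ker lfunE /=.
  by rewrite diff_tangential.
by move=> /eqP dw; rewrite innerBl inner_tangential // subrr.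
Qed.

Lemma differentiable_coef F z i : U z -> gram z \in unitmx -> differentiable F z ->
  differentiable (fun y => normal_coef F y 0 i) z.
Proof.
move=> Uz uG dF; under eq_fun do rewrite mxE.
apply: differentiable_bigsumr => j; apply: differentiable_mul.
  under eq_fun do rewrite mxE; apply: differentiable_inner dF.
  exact: differentiable_egrad (h_C2 _) Uz.
by apply: differentiable_invmx uG => a b; exact: differentiable_gram.
Qed.

Lemma differentiable_tangential F z : U z -> gram z \in unitmx ->
  differentiable F z -> differentiable (tangential F) z.
Proof.
move=> Uz uG dF; apply: (differentiableB dF).
apply: differentiable_bigsum => i; apply: differentiable_scale.
  exact: differentiable_coef.
exact: differentiable_egrad (h_C2 _) Uz.
Qed.

(** Differentiate <tangential y, w> = 'D_w f y - sum_i lambda_i y * 'D_w h_i y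
    at x in the direction v. As 'D_w h_i x = 0, the derivatives of the lambda_i
    drop out, and only mixed second derivatives remain. *)
Lemma tangential_diff_sym (f : E -> R) (Uf : set E) x v w :
  C2_on Uf f -> Uf x -> U x -> gram x \in unitmx ->
  'd h x v = 0 -> 'd h x w = 0 ->
  inner ('d (tangential (egrad f)) x v) w = inner ('d (tangential (egrad f)) x w) v.
Proof.
move=> fC2 Ufx Ux uG dv dw; have [oUf df dDf] := fC2.
have dG : differentiable (tangential (egrad f)) x.
  exact: differentiable_tangential (differentiable_egrad fC2 Ufx).
have formula u1 u2 : 'd h x u1 = 0 -> 'd h x u2 = 0 ->
    inner ('d (tangential (egrad f)) x u1) u2 = 'D_u1 ('D_u2 f) x
    - \sum_i normal_coef (egrad f) x 0 i * 'D_u1 ('D_u2 (fun z => h z 0 i)) x.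
  move=> du1 du2.
  have -> : inner ('d (tangential (egrad f)) x u1) u2
      = 'D_u1 (innerr u2 \o tangential (egrad f)) x.
    have dI y : differentiable (innerr u2) y.
      by apply: linear_differentiable; exact: innerr_continuous.
    rewrite deriveE; last exact: differentiable_comp.
    by rewrite diff_comp //= diff_lin //; exact: innerr_continuous.
  pose F i z := normal_coef (egrad f) z 0 i * 'D_u2 (fun z => h z 0 i) z.
  have -> : 'D_u1 (innerr u2 \o tangential (egrad f)) x
      = 'D_u1 ('D_u2 f - \sum_i F i) x.
    apply: near_eq_derive.
    apply: filterS2 (open_nbhs_nbhs (conj oUf Ufx)) (open_nbhs_nbhs (conj U_open Ux)).
    move=> z Ufz Uz; rewrite /= /innerr innerBl inner_suml egradP -deriveE; last exact: df.
    rewrite -![(_ - _) z]/(_ z - _ z); congr (_ - _).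
    rewrite fct_sumE; apply: eq_bigr => i _.
    rewrite innerZl egradP -deriveE //.
    by have [_ dh _] := h_C2 i; exact: dh.
  have dF i : is_derive x u1 (F i)
     (normal_coef (egrad f) x 0 i * 'D_u1 ('D_u2 (fun z => h z 0 i)) x).
    have [_ dh dDh] := h_C2 i.
    have d1 : differentiable (fun z => normal_coef (egrad f) z 0 i) x.
      exact: differentiable_coef (differentiable_egrad fC2 Ufx).
    have D1 := derivableP (diff_derivable (v := u1) d1).
    have D2 := derivableP (diff_derivable (v := u1) (dDh u2 x Ux)).
    have := is_deriveM D1 D2.
    have -> : 'D_u2 (fun z => h z 0 i) x = 0.
      by rewrite deriveE ?coord_diff ?du2 ?mxE //; [exact: h_diff|exact: dh].
    by rewrite scale0r addr0; exact.
  have D3 := derivableP (diff_derivable (v := u1) (dDf u2 x Ufx)).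
  by have [_ <-] := is_deriveB D3 (is_derive_sum dF).
have young_on (V : set E) (g : E -> R) u1 u2 : C2_on V g -> V x ->
    'D_u1 ('D_u2 g) x = 'D_u2 ('D_u1 g) x.
  move=> [oV dg dDg] Vx; apply: young; [|exact: dDg|exact: dDg].
  exact: filterS (open_nbhs_nbhs (conj oV Vx)).
have hess_sym i : 'D_v ('D_w (fun z => h z 0 i)) x = 'D_w ('D_v (fun z => h z 0 i)) x.
  exact: young_on (h_C2 i) Ux.
rewrite (formula v w dv dw) (formula w v dw dv) (young_on Uf f v w fC2 Ufx).
move: ('D_w ('D_v f) x) => a.
apply: (congr1 (fun s => a - s)).
apply: eq_bigr => i _.
by rewrite hess_sym.
Qed.

Variable M : set E.
Hypothesis M_zero : forall y, U y -> (M y <-> h y = 0).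

(** One inclusion differentiates h along a curve of M; the other one is
    [constraint_curve]. *)
Lemma tangent_ker z : U z -> M z -> gram z \in unitmx ->
  tangent M z = [set` lker (linfun ('d h z))].
Proof.
move=> Uz Mz uG; apply/seteqP; split => v /=; rewrite memv_ker lfunE /=.
  case=> c [c0 Mc [cd cE]].
  have dc : differentiable c (0 : R) by exact/derivable1_diffP.
  have Uc : \forall t \near (0 : R), U (c t).
    apply: (differentiable_continuous dc); rewrite c0.
    exact: (open_nbhs_nbhs (conj U_open Uz)).
  have hc0 : \forall t \near (0 : R), 0 = (h \o c) t.
    by apply: filterS2 Uc Mc => t Ut /(M_zero Ut).
  have dh : differentiable h (c 0) by rewrite c0; exact: h_diff.
  have := near_eq_derive (1 : R) hc0.
  rewrite derive_cst deriveE; last exact: differentiable_comp.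
  by rewrite diff_comp //= -[X in 'd h _ X]deriveE // cE c0 => <-.
move=> /eqP dv0; have [a a0 aB] := normal_comb_bound z.
have [c [c0 Uc cd]] := constraint_curve U_open Uz h_diff h_C2 a0 aB
  (fun s => diff_normal_comb s Uz uG) (proj1 (M_zero Uz) Mz) dv0.
exists c; split => //.
by apply: filterS Uc => t [Ut ht]; apply/(M_zero Ut).
Qed.

Lemma rgrad_near f x : U x -> gram x \in unitmx ->
  \forall z \near x, M z -> rgrad M f z = tangential (egrad f) z.
Proof.
move=> Ux uG.
apply: filterS2 (open_nbhs_nbhs (conj U_open Ux)) (near_gram_unit Ux uG).
by move=> z Uz uGz Mz; rewrite /rgrad tangent_ker // oproj_ker.
Qed.

(** On M near x, the Riemannian gradient coincides with a field which is
    differentiable at x, so that the chain rule computes its derivative along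
    every curve. *)
Lemma mderive_rgrad f (Uf : set E) x v : C2_on Uf f -> Uf x ->
  U x -> M x -> gram x \in unitmx ->
  tangent M x v -> mderive M (rgrad M f) x v = 'd (tangential (egrad f)) x v.
Proof.
move=> fC2 Ufx Ux Mx uG tv.
have dG : differentiable (tangential (egrad f)) x.
  exact: differentiable_tangential (differentiable_egrad fC2 Ufx).
have along c : curve_through M x v c ->
    is_derive (0 : R) 1 (rgrad M f \o c) ('d (tangential (egrad f)) x v).
  move=> [c0 Mc [cd cE]].
  have dc : differentiable c (0 : R) by exact/derivable1_diffP.
  have : \forall t \near (0 : R), M (c t) -> rgrad M f (c t) = tangential (egrad f) (c t).
    have cx : c t @[t --> (0 : R)] --> x.
      by rewrite -[in X in _ --> X]c0; exact: (differentiable_continuous dc).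
    exact: (cx _ (rgrad_near f Ux uG)).
  move=> near_eq.
  apply: (near_eq_is_derive (f := tangential (egrad f) \o c)).
    by apply: filterS2 near_eq Mc => t /= H /H ->.
  have dGc : differentiable (tangential (egrad f)) (c 0) by rewrite c0.
  apply: DeriveDef; first by apply: diff_derivable; exact: differentiable_comp.
  rewrite deriveE; last exact: differentiable_comp.
  by rewrite diff_comp //= -[X in 'd _ _ X]deriveE // cE c0.
apply: xget_unique => // w H; have [c cc] := tv.
by have [_ <-] := H c cc; have [_ <-] := along c cc.
Qed.

End Chart.

Section RiemannianHessian.
Context {R : realType} {E : euclideanType R}.

(** In a chart h around x, the Hessian is the projection onto the kernel of
    ['d h x] of the differential at x of [tangential h (egrad f)], whose
    bilinear form on this kernel is symmetric by [tangential_diff_sym]. *)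
Theorem rhess_symmetric (M : set E) (f : E -> R) (U : set E) x :
  embedded_submanifold M -> open U -> M `<=` U -> class_C 2 U f -> M x ->
  exists W : {vspace E}, [/\ tangent M x = [set` W],
    forall a u w, u \in W -> w \in W ->
      rhess M f x (a *: u + w) = a *: rhess M f x u + rhess M f x w &
    forall u w, u \in W -> w \in W ->
      inner (rhess M f x u) w = inner (rhess M f x w) u].
Proof.
move=> [k Mchart] oU MU /(class_C2_on oU) fC2 Mx.
have [Uh [h [[oUh Uhx] hC M_zero surj]]] := Mchart x Mx.
have h_diff : forall z, Uh z -> differentiable h z by case: (hC 1%N).
have h_C2 i : C2_on Uh (fun z => h z 0 i).
  split => // [z Uz|v z Uz].
    exact: (differentiable_comp (h_diff z Uz) (differentiable_coord _ _ _)).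
  apply: (@near_eq_differentiable _ _ _ (fun y => ('D_v h y) 0 i)).
    apply: filterS (open_nbhs_nbhs (conj oUh Uz)) => y Uy.
    by rewrite derive_mx ?mxE //; apply: diff_derivable; exact: h_diff.
  have dDh : differentiable ('D_v h) z.
    by have [_ /(_ v)[+ _]] := hC 2%N; apply.
  exact: (differentiable_comp dDh (differentiable_coord _ _ _)).
have uG := gram_unit h_diff Uhx surj.
have tE := tangent_ker oUh h_diff h_C2 M_zero Uhx Mx uG.
set W := lker _ in tE; exists W; split => //.
  have HE u : u \in W -> rhess M f x u =
      oproj [set` W] ('d (tangential h (egrad f)) x u).
    move=> uW; rewrite /rhess tE (mderive_rgrad oUh h_diff h_C2 M_zero fC2) ?tE //.
    exact: MU.
  move=> a u w uW wW; rewrite !HE ?memvD ?memvZ //.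
  rewrite linearD linearZ /=; apply: oproj_eq.
    by rewrite memvD ?memvZ // (oproj_vspaceP _ _).1.
  move=> z zW; rewrite innerBl !innerDl !innerZl !inner_oproj //.
  by rewrite subrr.
move=> u w uW wW.
have HE u' w' : u' \in W -> w' \in W -> inner (rhess M f x u') w' =
    inner ('d (tangential h (egrad f)) x u') w'.
  move=> u'W w'W; rewrite /rhess tE (mderive_rgrad oUh h_diff h_C2 M_zero fC2) ?tE //.
    by rewrite inner_oproj.
  exact: MU.
rewrite !HE //; apply: (tangential_diff_sym oUh h_diff h_C2 fC2) => //.
- exact: MU.
- by move: uW; rewrite memv_ker lfunE /= => /eqP.
- by move: wW; rewrite memv_ker lfunE /= => /eqP.
Qed.

End RiemannianHessian.

(** * Iterations and runs *)

Section OneIteration.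
Context {R : realType} {E : euclideanType R}.
Variables (M : set E) (f : E -> R) (Retr : E -> E -> E) (Mc C gam : R).
Variables (V : {vspace E}) (x d : E).
Hypothesis Mc_gt0 : 0 < Mc.
Hypothesis gam_bounds : Mc <= gam < C.
Hypothesis H_lin : forall a u w, u \in V -> w \in V ->
  rhess M f x (a *: u + w) = a *: rhess M f x u + rhess M f x w.
Hypothesis H_sym : forall u w, u \in V -> w \in V ->
  inner (rhess M f x u) w = inner (rhess M f x w) u.
Hypothesis dV : d \in V.
Hypothesis d_min : forall u, u \in V ->
  cubic_model M f gam x d <= cubic_model M f gam x u.

Let gam_ge0 : 0 <= gam.
Proof. by case/andP: gam_bounds => + _; apply: le_trans; exact: ltW. Qed.

Let cubic_min u : u \in V -> cubic (rgrad M f x) (rhess M f x) gam d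
  <= cubic (rgrad M f x) (rhess M f x) gam u.
Proof. by move=> /d_min; rewrite /cubic_model /cubic -!addrA lerD2l. Qed.

Lemma iteration_decrease : value_accuracy M f Retr Mc x d ->
  Mc / 12 * `|d| ^+ 3 <= f x - f (Retr x d).
Proof.
rewrite /value_accuracy ler_norml => /andP[_].
have := cubic_descent H_lin H_sym gam_ge0 dV cubic_min.
rewrite (innerC d) (innerC d).
have : Mc * `|d| ^+ 3 <= gam * `|d| ^+ 3.
  by rewrite ler_wpM2r ?exprn_ge0 //; case/andP: gam_bounds.
lra.
Qed.

Lemma iteration_gradient : rgrad M f x \in V -> grad_accuracy M f Retr Mc x d ->
  hess_accuracy M f Mc V x d ->
  `|rgrad M f (Retr x d)| <= (2 * Mc + C) / 2 * `|d| ^+ 2.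
Proof.
move=> gV gacc hacc; have := cubic_residual H_lin H_sym gam_ge0 dV cubic_min gV.
move: gacc hacc; rewrite /grad_accuracy /hess_accuracy.
set g' := rgrad _ _ (Retr x d); set g := rgrad _ _ x; set Hd := rhess _ _ _ _.
set P := oproj _ _ => gacc hacc res.
have -> : g' = (g' - g - Hd) - (P - Hd) + (g + P).
  by rewrite opprB [X in X + _]addrA subrK -[X in X + _]addrA -opprD subrK.
apply: le_trans (ler_normD _ _) _; rewrite res.
apply: le_trans (lerD (le_trans (ler_normB _ _) (lerD gacc hacc)) (lexx _)) _.
have : gam * `|d| ^+ 2 <= C * `|d| ^+ 2.
  by rewrite ler_wpM2r ?exprn_ge0 // ltW //; case/andP: gam_bounds.
lra.
Qed.

End OneIteration.

Section Run.
Context {R : realType} {E : euclideanType R}.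
Variables (M : set E) (f : E -> R) (U : set E) (Retr : E -> E -> E) (x0 : E) (Mc C : R).
Hypothesis M_manifold : embedded_submanifold M.
Hypothesis U_open : open U.
Hypothesis M_sub_U : M `<=` U.
Hypothesis f_C2 : class_C 2 U f.
Hypothesis Retr_retraction : retraction M Retr.
Hypothesis x0_in_M : M x0.
Hypothesis Mc_gt0 : 0 < Mc.
Hypothesis f_bounded_below : has_lbound (f @` M).
Variables (eps : R) (x d : nat -> E) (V : nat -> {vspace E}) (gamma : nat -> R).
Hypothesis run : rdrsom M f Retr eps x0 x d V gamma.
Hypothesis acc : rdrsom_assumptions M f Retr Mc C eps x d V gamma.

Local Notation gap := (f x0 - inf (f @` M)).

Lemma performed_le j k : (j <= k)%N -> performed M f eps x k -> performed M f eps x j.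
Proof. by move=> jk Hk i ij; apply: Hk; exact: leq_trans jk. Qed.

Lemma run_step k : performed M f eps x k -> M (x k) ->
  [/\ M (x k.+1), Mc / 12 * `|d k| ^+ 3 <= f (x k) - f (x k.+1) &
      `|rgrad M f (x k.+1)| <= (2 * Mc + C) / 2 * `|d k| ^+ 2].
Proof.
move=> Hk Mxk; have [VT gam0 dV dmin ->] := run.2 k Hk.
have [vacc gacc hacc gV gb] := acc Hk.
have [W [tE Hlin Hsym]] := rhess_symmetric M_manifold U_open M_sub_U f_C2 Mxk.
have VW u : u \in V k -> u \in W by move=> uV; have := VT u uV; rewrite tE.
have [RM _ _] := Retr_retraction Mxk.
split; first by apply: RM; apply: VT.
- apply: (iteration_decrease Mc_gt0 gb _ _ dV dmin) => //.
    by move=> a u w /VW uW /VW wW; exact: Hlin.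
  by move=> u w /VW uW /VW wW; exact: Hsym.
- apply: (iteration_gradient Mc_gt0 gb _ _ dV dmin gV gacc hacc).
    by move=> a u w /VW uW /VW wW; exact: Hlin.
  by move=> u w /VW uW /VW wW; exact: Hsym.
Qed.

(** The membership in M is part of the induction, since the Hessian is
    symmetric, and the retraction is constrained, at points of M only. *)
Lemma total_decrease n : (forall k, (k < n)%N -> performed M f eps x k) ->
  M (x n) /\ Mc / 12 * \sum_(k < n) `|d k| ^+ 3 <= f x0 - f (x n).
Proof.
elim: n => [_|n IH Hn]; first by rewrite run.1 big_ord0 mulr0 subrr.
have [|Mxn sumn] := IH; first by move=> k kn; apply: Hn; exact: ltnW.
have [MxS dec _] := run_step (Hn n (ltnSn n)) Mxn; split => //.
by rewrite big_ord_recr /= mulrDr; move: sumn dec; lra.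
Qed.

Lemma iterate_in_manifold n : (forall k, (k < n)%N -> performed M f eps x k) -> M (x n).
Proof. by move/total_decrease => []. Qed.

Lemma gap_ge0 : 0 <= gap.
Proof. by rewrite subr_ge0; apply: ge_inf => //; exists x0. Qed.

(** Otherwise every cube |d k|^3 exceeds this bound, and [total_decrease]
    contradicts the lower bound of f. *)
Lemma small_step n : (0 < n)%N -> performed M f eps x n.-1 ->
  exists2 k, (k < n)%N & `|d k| ^+ 3 <= 12 * gap / (Mc * n%:R).
Proof.
move=> n0 Hn; apply: contrapT => large.
have Hk k : (k < n)%N -> performed M f eps x k.
  by move=> kn; apply: performed_le Hn; rewrite -ltnS prednK.
have [Mxn sumn] := total_decrease Hk.
have fxn : inf (f @` M) <= f (x n) by apply: ge_inf => //; exists (x n).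
have nR : 0 < n%:R :> R by rewrite ltr0n.
have : \sum_(k < n) (12 * gap / (Mc * n%:R)) < \sum_(k < n) `|d k| ^+ 3.
  apply: ltr_sum => [|k _]; first by apply/hasP; exists (Ordinal n0); rewrite ?mem_index_enum.
  by rewrite ltNge; apply/negP => kle; apply: large; exists k.
rewrite sumr_const card_ord -[_ *+ n]mulr_natr; apply/negP; rewrite -leNgt.
have -> : 12 * gap / (Mc * n%:R) * n%:R = 12 / Mc * gap.
  by field; rewrite !gt_eqF.
apply: le_trans (_ : 12 / Mc * (f x0 - f (x n)) <= _); last first.
  by rewrite ler_wpM2l ?divr_ge0 ?(ltW Mc_gt0) // lerD2l lerN2.
apply: le_trans (ler_wpM2l _ sumn); last by rewrite divr_ge0 ?(ltW Mc_gt0).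
by rewrite mulrA (_ : 12 / Mc * (Mc / 12) = 1) ?mul1r //; field; rewrite gt_eqF.
Qed.

Lemma small_gradient n : (0 < n)%N -> performed M f eps x n.-1 ->
  exists2 k, (k < n)%N & `|rgrad M f (x k.+1)| <=
    (2 * Mc + C) / 2 * (12 * gap / (Mc * n%:R)) `^ (2 / 3).
Proof.
move=> n0 Hn; have [k kn dk] := small_step n0 Hn; exists k => //.
have Hk j : (j <= k)%N -> performed M f eps x j.
  by move=> jk; apply: performed_le Hn; rewrite -ltnS prednK // (leq_ltn_trans jk).
have [|_ _ /le_trans] := run_step (Hk k (leqnn k)).
  by apply: iterate_in_manifold => j /ltnW; exact: Hk.
apply; apply: ler_wpM2l.
  have [_ _ _ _ /andP[Mg gC]] := acc (Hk k (leqnn k)).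
  by rewrite divr_ge0 // addr_ge0 ?mulr_ge0 ?(ltW Mc_gt0) // (le_trans _ (ltW gC)) //
    (le_trans _ Mg) // ltW.
have -> : `|d k| ^+ 2 = (`|d k| ^+ 3) `^ (2 / 3).
  rewrite -!powR_mulrn // -powRrM; congr (_ `^ _); by field.
by apply: ge0_ler_powR; rewrite ?nnegrE ?exprn_ge0 // (le_trans _ dk) ?exprn_ge0.
Qed.

End Run.

(** * Rate and complexity *)

Theorem theorem2p4 (R : realType) (E : euclideanType R) (M : set E)
  (f : E -> R) (U : set E) (Retr : E -> E -> E) (x0 : E) (Mc C : R)
  (M_manifold : embedded_submanifold M)
  (U_open : open U) (M_sub_U : M `<=` U) (f_C2 : class_C 2 U f)
  (Retr_retraction : retraction M Retr)
  (x0_in_M : M x0)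
  (Mc_gt0 : 0 < Mc)
  (f_bounded_below : has_lbound (f @` M)) :
  let fstar := inf (f @` M) in
  (forall (eps : R) (x d : nat -> E) (V : nat -> {vspace E})
          (gamma : nat -> R),
     0 < eps ->
     rdrsom M f Retr eps x0 x d V gamma ->
     rdrsom_assumptions M f Retr Mc C eps x d V gamma ->
     forall N : nat, (1 <= N)%N -> performed M f eps x N ->
       \big[Num.min/`|rgrad M f (x 0%N)|]_(k < N.+2) `|rgrad M f (x k)|
       <= 12 `^ (2 / 3) * (2 * Mc + C) / (2 * Mc `^ (2 / 3))
          * ((f x0 - fstar) / N%:R) `^ (2 / 3))
  /\
  (exists K : R, forall (eps : R) (x d : nat -> E) (V : nat -> {vspace E})
                        (gamma : nat -> R),
     0 < eps ->
     rdrsom M f Retr eps x0 x d V gamma ->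
     rdrsom_assumptions M f Retr Mc C eps x d V gamma ->
     exists n : nat, terminates_after M f eps x n /\
                     n%:R <= K * eps `^ (- (3 / 2))).
Proof.
move=> fstar; have gap0 : 0 <= f x0 - fstar := gap_ge0 x0_in_M f_bounded_below.
pose c := (2 * Mc + C) / 2.
have cE eps x d V gamma : rdrsom_assumptions M f Retr Mc C eps x d V gamma ->
    performed M f eps x 0 -> 0 < c.
  move=> acc /acc[_ _ _ _ /andP[Mg gC]].
  by rewrite divr_gt0 // addr_gt0 ?mulr_gt0 // (lt_trans _ gC) // (lt_le_trans _ Mg).
split.
  move=> eps x d V gamma eps0 run acc N N1 HN.
  have [|k kN xk] := small_gradient M_manifold U_open M_sub_U f_C2 Retr_retraction
    x0_in_M Mc_gt0 f_bounded_below run acc N1.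
    by apply: performed_le HN; exact: leq_pred.
  have kN2 : (k.+1 < N.+2)%N by rewrite ltnS ltnW.
  apply: le_trans (bigmin_le _ (Ordinal kN2) _) _.
  apply: le_trans xk _; rewrite le_eqVlt; apply/orP; left; apply/eqP.
  have NR : 0 < N%:R :> R by rewrite ltr0n.
  have -> : 12 * (f x0 - inf (f @` M)) / (Mc * N%:R)
      = 12 / Mc * ((f x0 - fstar) / N%:R).
    by rewrite /fstar; field; rewrite !gt_eqF.
  rewrite [(12 / Mc * _) `^ _]powRM ?divr_ge0 ?(ltW Mc_gt0) //.
  have McR : 0 < Mc `^ (2 / 3) by rewrite powR_gt0.
  have -> : 12 `^ (2 / 3) = (12 / Mc) `^ (2 / 3) * Mc `^ (2 / 3).
    by rewrite -powRM ?divr_ge0 ?(ltW Mc_gt0) // divfK // gt_eqF.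
  by field; rewrite gt_eqF.
(* K1 bounds the iterations after the first one; the other term of the constant
   pays for that one, because eps is at most the initial gradient norm as soon as
   one iteration is performed. *)
pose K1 := c `^ (3 / 2) * (12 * (f x0 - fstar) / Mc).
have K10 : 0 <= K1.
  by rewrite mulr_ge0 ?powR_ge0 // divr_ge0 ?mulr_ge0 // ltW.
pose G0 := `|rgrad M f x0|.
exists (K1 + G0 `^ (3 / 2)) => eps x d V gamma eps0 run acc.
have eps32 : 0 < eps `^ (3 / 2) by rewrite powR_gt0.
have bound n : performed M f eps x n -> n%:R <= K1 * eps `^ (- (3 / 2)).
  move=> Hn; case: n Hn => [|n] Hn; first by rewrite mulr_ge0 // powR_ge0.
  have [|k kn dk] := small_step M_manifold U_open M_sub_U f_C2 Retr_retraction
    x0_in_M Mc_gt0 f_bounded_below run acc (ltn0Sn n).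
    by apply: performed_le Hn; exact: leqnSn.
  have Hk : performed M f eps x k by apply: performed_le Hn; exact: ltnW.
  have [|_ _ gk] := run_step M_manifold U_open M_sub_U f_C2 Retr_retraction
      Mc_gt0 run acc Hk.
    apply: (iterate_in_manifold M_manifold U_open M_sub_U f_C2 Retr_retraction
      x0_in_M Mc_gt0 run acc) => j jk; apply: performed_le Hk; exact: ltnW.
  have c0 : 0 < c by apply: (cE _ _ _ _ _ acc); exact: performed_le Hk.
  have := le_trans (Hn k.+1 kn) gk; rewrite -/c => ec.
  have e32 : eps `^ (3 / 2) <= c `^ (3 / 2) * `|d k| ^+ 3.
    apply: le_trans (ge0_ler_powR _ _ _ ec) _; rewrite ?nnegrE ?(ltW eps0) //.
      by rewrite mulr_ge0 ?exprn_ge0 // ltW.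
    rewrite powRM ?exprn_ge0 ?(ltW c0) // -!powR_mulrn // -powRrM.
    by rewrite (_ : 2 * (3 / 2) = 3) //; field.
  have {}e32 := le_trans e32 (ler_wpM2l (powR_ge0 _ _) dk).
  rewrite powRN ler_pdivlMr //; apply: le_trans (ler_wpM2l (ler0n _ _) e32) _.
  rewrite le_eqVlt; apply/orP; left; apply/eqP.
  by rewrite /K1 /fstar; field; rewrite gt_eqF //= nat1r pnatr_eq0.
have stops : exists n, `|rgrad M f (x n)| < eps.
  apply: contrapT => never.
  have always n : performed M f eps x n.
    by move=> j _; rewrite leNgt; apply/negP => H; apply: never; exists j.
  have B0 : 0 <= K1 * eps `^ (- (3 / 2)) by rewrite mulr_ge0 // powR_ge0.
  by have := archi_boundP B0; rewrite ltNge bound.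
case: (ex_minnP stops) => n xn minn.
have Hlt j : (j < n)%N -> eps <= `|rgrad M f (x j)|.
  by move=> jn; rewrite leNgt; apply/negP => /minn; rewrite leqNgt jn.
exists n; split; first by split.
case: n xn minn Hlt => [|n] xn minn Hlt.
  by rewrite mulr_ge0 ?powR_ge0 // addr_ge0 // powR_ge0.
rewrite -natr1 mulrDl lerD ?bound //.
rewrite powRN ler_pdivlMr // mul1r.
have := Hlt 0%N isT; rewrite run.1 => eG.
by apply: ge0_ler_powR; rewrite ?nnegrE ?(ltW eps0) ?normr_ge0 ?divr_ge0.
Qed.
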